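(* Let $\Omega\subseteq\mathbb{R}^2$ be a domain. Consider the Dirichlet problem associated to the $H_R=H_L$ surface equation over $\Omega$, that is, the problem of finding a smooth function $u$ with $$\mathrm{div}\left(\left(\frac{1}{\sqrt{1-|Du|^2}}-\frac{1}{\sqrt{1+|Du|^2}}\right)Du\right)=0\ \text{ and }\ |Du|<1\ \text{ on }\Omega,\qquad u=\varphi\ \text{ on }\partial\Omega,$$ where $\varphi$ is a prescribed function on $\partial\Omega$. If $u$ is a solution to this Dirichlet problem such that its graph has non-vanishing mean curvature, then $u$ is the only solution.
   Context: $D$, $|\cdot|$ and $\mathrm{div}$ denote the gradient, norm and divergence in the Euclidean plane $\mathbb{R}^2$. For a smooth function $u$ on $\Omega$ with $|Du|<1$, the graph $\Sigma_u=\{(x,y,u(x,y)):(x,y)\in\Omega\}$ is a spacelike surface in the Lorentz-Minkowski space $\mathbb{L}^3$ (that is, $\mathbb{R}^3$ with the metric $dx^2+dy^2-dz^2$; spacelike means that the induced metric is Riemannian). Its mean curvature functions in Euclidean space $\mathbb{R}^3$ (with respect to the upward unit normal) and in $\mathbb{L}^3$ (with respect to the future-directed unit normal) are, at the point $(x,y,u(x,y))$, $$H_R=\tfrac12\,\mathrm{div}\left(\frac{Du}{\sqrt{1+|Du|^2}}\right)(x,y),\qquad H_L=\tfrac12\,\mathrm{div}\left(\frac{Du}{\sqrt{1-|Du|^2}}\right)(x,y).$$ The equation in the claim, called the $H_R=H_L$ surface equation, says exactly that $H_R=H_L$ on $\Sigma_u$. For its solutions, ''the mean curvature'' of the graph is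 this common value, and ''non-vanishing'' means that it is nonzero at every point of the graph.
   Formalization: The domain Ω is assumed bounded: on the unbounded domain r > 1 with φ = 0, the radial solutions with r·u'(1/√(1−u'²) − 1/√(1+u'²)) = c, one for each c > 0, are distinct and have non-vanishing mean curvature, so the claim fails there. *)

(* Defs.v *)
From mathcomp Require Import all_boot all_order all_algebra.
From mathcomp Require Import all_classical all_reals all_analysis.

Set Implicit Arguments.
Unset Strict Implicit.
Unset Printing Implicit Defensive.

Import Order.TTheory GRing.Theory Num.Theory.
Import numFieldNormedType.Exports.

Local Open Scope classical_set_scope.
Local Open Scope ring_scope.

(* The Euclidean norm of the plane.  The library norm `|v| on row vectors is the
   sup norm; it induces the same topology and the same bounded sets, so it is
   harmless in [open], [closure], [continuous] and [bounded_set], but it is not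
   the norm |Du| of the equation. *)
Definition enorm (R : realType) (v : 'rV[R]_2) : R :=
  Num.sqrt (\sum_(i < 2) v 0 i ^+ 2).

Definition domain (R : realType) (Omega : set 'rV[R]_2) : Prop :=
  [/\ open Omega, Omega !=set0 & connected Omega].

Definition boundary (R : realType) (A : set 'rV[R]_2) : set 'rV[R]_2 :=
  closure A `\` interior A.

(* Like ['D_v f x], [partial i f x] is total: it is the partial derivative only
   where that exists. *)
Definition partial (R : realType) (i : 'I_2) (f : 'rV[R]_2 -> R)
    (x : 'rV[R]_2) : R :=
  'D_(delta_mx 0 i) f x.

(* C^oo on an open set: the partial derivatives of all orders (s lists the
   successive directions of derivation) exist and are continuous there. *)
Definition smooth_on (R : realType) (Omega : set 'rV[R]_2)
    (f : 'rV[R]_2 -> R) : Prop :=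
  forall (s : seq 'I_2) (x : 'rV[R]_2), Omega x ->
    let g := foldr (@partial R) f s in
    {for x, continuous g} /\ forall i : 'I_2, derivable g x (delta_mx 0 i).

Definition grad (R : realType) (u : 'rV[R]_2 -> R) (x : 'rV[R]_2) : 'rV[R]_2 :=
  \row_(i < 2) partial i u x.

Definition div (R : realType) (X : 'rV[R]_2 -> 'rV[R]_2) (x : 'rV[R]_2) : R :=
  \sum_(i < 2) partial i (fun y => X y 0 i) x.

(* The mean curvature of the graph of u, at (x, u(x)), in Euclidean space. *)
Definition HR (R : realType) (u : 'rV[R]_2 -> R) (x : 'rV[R]_2) : R :=
  2^-1 * div (fun y => (Num.sqrt (1 + enorm (grad u y) ^+ 2))^-1 *: grad u y) x.

Definition HR_HL_equation (R : realType) (u : 'rV[R]_2 -> R)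
    (x : 'rV[R]_2) : Prop :=
  div (fun y => ((Num.sqrt (1 - enorm (grad u y) ^+ 2))^-1
               - (Num.sqrt (1 + enorm (grad u y) ^+ 2))^-1) *: grad u y) x = 0.

(* Continuity on the closure of Omega is what gives the boundary condition its
   meaning.  Only the values of phi on the boundary matter, and only those of u
   on the closure of Omega.  As usual for this problem, uniqueness presupposes a
   bounded Omega: on {r > 1} with phi = 0, the radial functions u with
   r u' (1 / sqrt (1 - u'^2) - 1 / sqrt (1 + u'^2)) = c, one for each c > 0, are
   distinct solutions with non-vanishing mean curvature. *)
Definition dirichlet_solution (R : realType) (Omega : set 'rV[R]_2)
    (phi u : 'rV[R]_2 -> R) : Prop :=
  [/\ smooth_on Omega u,
      {within closure Omega, continuous u},
      forall x, Omega x -> HR_HL_equation u x,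
      forall x, Omega x -> enorm (grad u x) < 1
    & forall x, boundary Omega x -> u x = phi x].

(* On a solution H_R = H_L, so the common value of the two mean curvatures is
   represented by H_R. *)
Definition nonvanishing_mean_curvature (R : realType) (Omega : set 'rV[R]_2)
    (u : 'rV[R]_2 -> R) : Prop :=
  forall x, Omega x -> HR u x != 0.

(* Main.v *)
Require Import Defs.
From mathcomp Require Import all_boot all_order all_algebra.
From mathcomp Require Import all_classical all_reals all_analysis.
From mathcomp Require Import ring lra.
Import numFieldNormedType.Exports.

(** The equation is div A(Du) = 0 with A(p) = coef(|p|^2) p and
    coef(s) = 1 / sqrt (1 - s) - 1 / sqrt (1 + s).  On [0, 1) the function coef
    vanishes at 0 and increases strictly, so A is strictly monotone on the unit
    disc ([coef_monotone], [coef_strictly_monotone]):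
      (A(p) - A(q)) . (p - q) >= 0, with equality only for p = q.
    Degeneracy at p = 0 (where the derivative of A vanishes) does no harm to this
    strict monotonicity, and uniqueness follows by an energy argument.

    Let u and v be solutions with the same boundary values, let e > 0, and put
    w = u - v - e and psi = (max 0 w)^2.  Near the boundary of Omega w is
    negative, so psi, extended by zero, is C^1 on the whole plane and has compact
    support; so has the field g = psi (A(Du) - A(Dv)), and
      div g = 2 (max 0 w) (A(Du) - A(Dv)) . (Du - Dv) >= 0
    because both fluxes are divergence free.  A compactly supported C^1 field
    with nonnegative divergence is divergence free ([div_ge0_eq0]), hence
    Du = Dv wherever w > 0.  So psi has gradient zero on the whole plane; having
    compact support, it vanishes, which says that u - v <= e.  Letting e tend to
    0 gives u <= v ([dirichlet_comparison]), and exchanging u and v gives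
    equality.

    The divergence fact is proved with one-dimensional integrals only.  Let h(b)
    be the flux of g through the horizontal line at height b, that is the
    integral of the second component of g.  Then h'(b) is the integral of div g
    over that line, since the first component contributes nothing by the
    fundamental theorem of calculus.  So h is nondecreasing, and it is zero for
    large |b|; therefore h and h' vanish identically, and a continuous
    nonnegative function with zero integral is zero. *)

Set Implicit Arguments.
Unset Strict Implicit.
Unset Printing Implicit Defensive.
Import Order.TTheory GRing.Theory Num.Theory.

Local Open Scope classical_set_scope.
Local Open Scope ring_scope.

(** * Functions with continuous partial derivatives *)

Definition C1_on (R : realType) (Omega : set 'rV[R]_2) (f : 'rV[R]_2 -> R) :=
  forall x, Omega x -> {for x, continuous f} /\
    forall i : 'I_2, derivable f x (delta_mx 0 i) /\ {for x, continuous (partial i f)}.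

Section Calculus.
Variable R : realType.
Local Notation V := 'rV[R]_2.
Implicit Types (f g : V -> R) (x v : V) (Omega : set V).

(** Restricting to a line turns directional derivatives into derivatives on R, for
    which a chain rule and the fundamental theorem of calculus are at hand. *)
Lemma is_derive_line f x v (t : R) : derivable f (x + t *: v) v ->
  is_derive t 1 (fun s : R => f (x + s *: v)) ('D_v f (x + t *: v)).
Proof.
have E : (fun h : R => h^-1 *: (((fun s : R => f (x + s *: v)) \o shift t) (h *: 1) -
            f (x + t *: v)))
  = (fun h : R => h^-1 *: ((f \o shift (x + t *: v)) (h *: v) - f (x + t *: v))).
  apply/funext => h /=; congr (_ *: (f _ - _)).
  by rewrite [h *: 1]mulr1 scalerDl addrCA.
by move=> df; split; rewrite /derivable /derive E.
Qed.

(** Restricting [f] to the line through [x] in the direction [v] reduces this to the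
    chain rule on R. *)
Lemma is_derive_comp_dir (phi : R -> R) f x v (a : R) :
  is_derive (f x) 1 phi a -> derivable f x v ->
  is_derive x v (phi \o f) (a * 'D_v f x).
Proof.
move=> dphi df.
have x0 : x + 0 *: v = x by rewrite scale0r addr0.
have dl := @is_derive_line f x v 0; rewrite x0 in dl.
have {}dl := dl df.
have dp : is_derive (f (x + 0 *: v)) 1 phi a by rewrite x0.
have dc := is_derive1_comp dp dl.
have E : (fun h : R => h^-1 *: (((phi \o (fun s : R => f (x + s *: v))) \o shift 0) (h *: 1) -
            (phi \o (fun s : R => f (x + s *: v))) 0))
  = (fun h : R => h^-1 *: (((phi \o f) \o shift x) (h *: v) - (phi \o f) x)).
  apply/funext => h /=; rewrite x0; congr (_ *: (phi (f _) - _)).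
  by rewrite [h *: 1]mulr1 addr0 addrC.
case: dc; rewrite /derivable /derive E => d1 d2; split => //.
Qed.

(** Both conclusions rest on [Omega] being open: partial derivatives at a point of
    [Omega], and their continuity there, only see values on [Omega]. *)
Lemma C1_eq_on Omega f g : open Omega -> (forall x, Omega x -> f x = g x) ->
  C1_on Omega f -> C1_on Omega g /\
  (forall x i, Omega x -> partial i g x = partial i f x).
Proof.
move=> oO fg Cf.
have nO x : Omega x -> \forall y \near x, Omega y.
  by move=> Ox; apply: open_nbhs_nbhs.
have nfg x : Omega x -> {near x, f =1 g}.
  by move=> Ox; near=> y; apply: fg; near: y; exact: nO.
have pfg x i : Omega x -> partial i g x = partial i f x.
  move=> Ox; apply/esym; rewrite /partial; apply: near_eq_derive; exact: nfg.
split=> // x Ox; have [cf df] := Cf _ Ox; split.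
  rewrite /prop_for /continuous_at -fg//.
  apply: cvg_trans cf; apply: (@near_eq_cvg _ _ (nbhs x)).
  by near=> y; apply: fg; near: y; exact: nO.
move=> i; have [d c] := df i; split.
  exact: (near_eq_derivable (nfg _ Ox)) d.
rewrite /prop_for /continuous_at pfg //.
apply: cvg_trans c; apply: (@near_eq_cvg _ _ (nbhs x)).
by near=> y; apply/esym; apply: pfg; near: y; exact: nO.
Unshelve. all: by end_near. Qed.

(** [partial] is a total operator given by a limit; this is how to bring in
    explicit formulas for it, which need only be valid on [Omega]. *)
Lemma C1_from_derivatives Omega f (df : 'I_2 -> V -> R) : open Omega ->
  (forall x, Omega x -> {for x, continuous f}) ->
  (forall i x, Omega x -> is_derive x (delta_mx 0 i) f (df i x)) ->
  (forall i x, Omega x -> {for x, continuous (df i)}) ->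
  C1_on Omega f.
Proof.
move=> oO cf hd cd x Ox; split; first exact: cf.
move=> i; split; first by have [] := hd i x Ox.
have pE y : Omega y -> partial i f y = df i y.
  by move=> Oy; have [_ <-] := hd i y Oy.
rewrite /prop_for /continuous_at pE //.
apply: cvg_trans (cd i x Ox); apply: (@near_eq_cvg _ _ (nbhs x)).
near=> y; apply/esym; apply: pE; near: y; exact: open_nbhs_nbhs.
Unshelve. all: by end_near. Qed.

Lemma C1_is_derive Omega f x i : C1_on Omega f -> Omega x ->
  is_derive x (delta_mx 0 i) f (partial i f x).
Proof. by move=> Cf Ox; have [_ /(_ i)[d _]] := Cf _ Ox; exact: derivableP. Qed.

Lemma C1_cst Omega (c : R) : open Omega -> C1_on Omega (fun=> c).
Proof.
move=> oO; apply: (@C1_from_derivatives _ _ (fun _ _ => 0)) => //.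
- by move=> x _; apply: cst_continuous.
- by move=> i x _; apply: cst_continuous.
Qed.

Lemma C1D Omega f g : open Omega -> C1_on Omega f -> C1_on Omega g ->
  C1_on Omega (fun x => f x + g x).
Proof.
move=> oO Cf Cg.
apply: (@C1_from_derivatives _ _ (fun i x => partial i f x + partial i g x)) => //.
- by move=> x Ox; apply: continuousD; [have [] := Cf _ Ox | have [] := Cg _ Ox].
- by move=> i x Ox; apply: (@is_deriveD R V R f g);
    [exact: C1_is_derive Cf _|exact: C1_is_derive Cg _].
- move=> i x Ox; apply: continuousD.
    by have [_ /(_ i)[]] := Cf _ Ox.
  by have [_ /(_ i)[]] := Cg _ Ox.
Qed.

Lemma C1M Omega f g : open Omega -> C1_on Omega f -> C1_on Omega g ->
  C1_on Omega (fun x => f x * g x).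
Proof.
move=> oO Cf Cg.
have cf x : Omega x -> {for x, continuous f} by move=> Ox; have [] := Cf _ Ox.
have cg x : Omega x -> {for x, continuous g} by move=> Ox; have [] := Cg _ Ox.
apply: (@C1_from_derivatives _ _ (fun i x => f x * partial i g x + g x * partial i f x)) => //.
- by move=> x Ox; apply: continuousM; [exact: cf|exact: cg].
- move=> i x Ox; apply: (@is_deriveM R V f g);
    [exact: C1_is_derive Cf _|exact: C1_is_derive Cg _].
- move=> i x Ox; apply: continuousD; apply: continuousM.
  + exact: cf.
  + by have [_ /(_ i)[]] := Cg _ Ox.
  + exact: cg.
  + by have [_ /(_ i)[]] := Cf _ Ox.
Qed.

Lemma C1B Omega f g : open Omega -> C1_on Omega f -> C1_on Omega g ->
  C1_on Omega (fun x => f x - g x).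
Proof.
move=> oO Cf Cg.
rewrite (_ : (fun x => _) = (fun x => f x + (-1) * g x)).
  exact: (C1D oO Cf (C1M oO (C1_cst (-1) oO) Cg)).
by apply/funext => x; rewrite mulN1r.
Qed.

Lemma C1_comp Omega (phi dphi : R -> R) f : open Omega -> C1_on Omega f ->
  (forall x, Omega x -> is_derive (f x) 1 phi (dphi (f x))) ->
  (forall x, Omega x -> {for f x, continuous dphi}) ->
  C1_on Omega (fun x => phi (f x)).
Proof.
move=> oO Cf hp cp.
have cf x : Omega x -> {for x, continuous f} by move=> Ox; have [] := Cf _ Ox.
apply: (@C1_from_derivatives _ _ (fun i x => dphi (f x) * partial i f x)) => //.
- move=> x Ox; apply: continuous_comp; first exact: cf.
  apply: differentiable_continuous; apply/derivable1_diffP.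
  by have [] := hp x Ox.
- move=> i x Ox; apply: is_derive_comp_dir; first exact: hp.
  by have [_ /(_ i)[]] := Cf _ Ox.
- move=> i x Ox; apply: continuousM.
    by apply: continuous_comp; [exact: cf|exact: cp].
  by have [_ /(_ i)[]] := Cf _ Ox.
Qed.

End Calculus.

Lemma ord2P (i : 'I_2) : i = 0 \/ i = 1.
Proof. by case: i => -[|[|//]] ?; [left|right]; apply/val_inj. Qed.

Lemma sum_ord2 (R : nmodType) (F : 'I_2 -> R) : \sum_i F i = F 0 + F 1.
Proof. by rewrite big_ord_recl big_ord1; congr (_ + F _); exact/val_inj. Qed.

(** * Compactly supported fields with nonnegative divergence *)

Section Divergence.
Variable R : realType.
Local Notation V := 'rV[R]_2.
Local Notation mu := (@lebesgue_measure R).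

Lemma continuous_integrable (f : R -> R) a b : continuous f ->
  mu.-integrable `[a, b] (EFin \o f).
Proof.
move=> cf; apply: continuous_compact_integrable; first exact: segment_compact.
exact: continuous_subspaceT.
Qed.

(** The primitive of [f] from [a] is squeezed between 0 and the full integral, so
    it vanishes on the whole interval, and so does its derivative [f]. *)
Lemma Rintegral_ge0_eq0 (f : R -> R) a b : continuous f -> (forall x, 0 <= f x) ->
  \int[mu]_(x in `[a, b]) f x = 0 -> forall x, a < x < b -> f x = 0.
Proof.
move=> cf f0 If x /andP[ax xb].
pose F (y : R) := \int[mu]_(t in `[a, y]) f t.
have F0 y : a < y < b -> F y = 0.
  move=> /andP[ay yb].
  have := @Rintegral_itvB R f (BLeft a) (BRight b) y (continuous_integrable a b cf).
  rewrite !bnd_simp (ltW ay) (ltW yb) => /(_ isT isT).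
  rewrite If sub0r => E; apply/eqP; rewrite eq_le; apply/andP; split.
    rewrite -oppr_ge0 E; exact: Rintegral_ge0.
  exact: Rintegral_ge0.
have [dF F'] := @continuous_FTC1_closed R f a x b xb (continuous_integrable a b cf) ax (cf x).
rewrite -F' derive1E (@near_eq_derive _ _ _ _ (cst 0)) ?derive_cst//.
have /near_in_itvoo : x \in `]a, b[ by rewrite in_itv/= ax.
apply: filterS => y; rewrite in_itv/= => yab; exact: F0.
Qed.

Definition pt (a b : R) : V := a *: delta_mx 0 0 + b *: delta_mx 0 1.

Lemma pt0 a b : pt a b 0 0 = a.
Proof. by rewrite !mxE/= mulr1 mulr0 addr0. Qed.

Lemma pt1 a b : pt a b 0 1 = b.
Proof. by rewrite !mxE/= mulr1 mulr0 add0r. Qed.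

Lemma ptE (x : V) : x = pt (x 0 0) (x 0 1).
Proof.
apply/matrixP => i j; rewrite !ord1.
by have [->|->] := ord2P j; rewrite ?pt0 ?pt1.
Qed.

Lemma cont_ptl (b : R) : continuous (fun a => pt a b).
Proof.
move=> a; rewrite /pt; apply: cvgD; last exact: cvg_cst.
exact: scalel_continuous.
Qed.

Lemma C1_derive_ptl (f : V -> R) (a b : R) : C1_on setT f ->
  is_derive a 1 (fun s => f (pt s b)) (partial 0 f (pt a b)).
Proof.
move=> Cf; have [_ /(_ 0)[d _]] := Cf (pt a b) I.
have := @is_derive_line R f (b *: delta_mx 0 1) (delta_mx 0 0) a.
by rewrite addrC => /(_ d); under eq_fun do rewrite addrC.
Qed.

Lemma C1_derive_ptr (f : V -> R) (a b : R) : C1_on setT f ->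
  is_derive b 1 (fun s => f (pt a s)) (partial 1 f (pt a b)).
Proof.
move=> Cf; have [_ /(_ 1)[d _]] := Cf (pt a b) I.
exact: (@is_derive_line R f (a *: delta_mx 0 0) (delta_mx 0 1) b d).
Qed.

Lemma C1_bound (f : V -> R) (B : R) : continuous f ->
  exists2 M, 0 <= M & forall x : V, (forall i, `|x 0 i| <= B) -> `|f x| <= M.
Proof.
move=> cf.
have cA : compact [set v : V | forall i, `[-B, B]%classic (v 0 i)].
  by apply: (@rV_compact R 2 (fun=> `[-B, B]%classic)) => i; exact: segment_compact.
have [M [_ HM]] := compact_bounded (continuous_compact (continuous_subspaceT cf) cA).
exists (`|M| + 1) => [|x xB]; first by rewrite addr_ge0.
apply: (HM (`|M| + 1)); first by rewrite (le_lt_trans (ler_norm M))// ltrDl.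
by exists x => // i; rewrite /= in_itv/= -ler_norml.
Qed.

(** Differentiation under the integral sign; the dominating function is a constant,
    a bound for the partial derivative on a square that contains
    [-B, B] x [b - 1, b + 1]. *)
Lemma derive_int_ptr (f : V -> R) (B b : R) : C1_on setT f ->
  is_derive b 1 (fun y => \int[mu]_(a in `[-B, B]) f (pt a y))
    (\int[mu]_(a in `[-B, B]) partial 1 f (pt a b)).
Proof.
move=> Cf.
have cf : continuous f by move=> x; have [] := Cf x I.
have cdf : continuous (partial 1 f) by move=> x; have [_ /(_ 1)[]] := Cf x I.
have [M M0 HM] := C1_bound (`|B| + `|b| + 1) cdf.
have dE y a : partial1of2 (fun y a => f (pt a y)) y a = partial 1 f (pt a y).
  by rewrite partial1of2E; have [] := C1_derive_ptr a y Cf.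
have Ib : `](b - 1), (b + 1)[%classic b by rewrite /= in_itv/= ltrBlDr !ltrDl !ltr01.
have mB : measurable (`[-B, B] : set (measurableTypeR R)) by exact: measurable_itv.
have intf y : `](b - 1), (b + 1)[%classic y ->
    mu.-integrable `[-B, B] (EFin \o (fun a => f (pt a y))).
  move=> _; apply: continuous_integrable => a.
  by apply: continuous_comp; [exact: cont_ptl|exact: cf].
have derf y a : `](b - 1), (b + 1)[%classic y -> `[-B, B]%classic a ->
    derivable ((fun y a => f (pt a y)) ^~ a) y 1.
  by move=> _ _; have [] := C1_derive_ptr a y Cf.
have intG : mu.-integrable `[-B, B] (EFin \o (fun _ : R => M)).
  by apply: continuous_integrable; exact: cst_continuous.
have Gub y a : `](b - 1), (b + 1)[%classic y -> `[-B, B]%classic a ->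
    `|partial1of2 (fun y a => f (pt a y)) y a| <= M.
  rewrite /= !in_itv/= => /andP[y1 y2] aB; rewrite dE; apply: HM => i.
  have [->|->] := ord2P i.
    rewrite pt0.
    have : `|a| <= B by rewrite ler_norml.
    have := ler_norm B; have := normr_ge0 b; lra.
  rewrite pt1.
  have : `|y - b| <= 1 by rewrite ler_norml; apply/andP; split; lra.
  have : `|y| <= `|y - b| + `|b| by rewrite -[X in `|X| <= _](subrK b) ler_normD.
  have := normr_ge0 B; lra.
have d1 := @derivable_under_integral R _ _ mu _ _ mB b _ _ Ib intf derf _ (fun=> M0) intG Gub.
have d2 := @differentiation_under_integral R _ _ mu _ _ mB b _ _ Ib intf derf _ (fun=> M0) intG Gub.
split; first exact: d1.
rewrite -derive1E d2; apply: eq_Rintegral => a _; exact: dE.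
Qed.

(** The flux [h y] of [G] through the line at height [y] has derivative the integral
    of the divergence over that line, so it is nondecreasing; as it vanishes
    below and above the support, it is constant, and the divergence has integral
    zero on every line. *)
Lemma div_ge0_eq0_in (G : 'I_2 -> V -> R) (B : R) : 0 < B ->
  (forall i, C1_on setT (G i)) ->
  (forall i (x : V), (exists j, B <= `|x 0 j|) -> G i x = 0) ->
  (forall x, 0 <= \sum_i partial i (G i) x) ->
  forall x : V, `|x 0 0| < B -> \sum_i partial i (G i) x = 0.
Proof.
move=> B0 CG G0 dG x xB; rewrite (ptE x).
set b := x 0 1; set a := x 0 0.
have cd i : continuous (partial i (G i)).
  by move=> y; have [_ /(_ i)[]] := CG i y I.
have cd' i c : continuous (fun a => partial i (G i) (pt a c)).
  by move=> y; apply: continuous_comp; [exact: cont_ptl|exact: cd].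
pose h y := \int[mu]_(a in `[-B, B]) G 1 (pt a y).
have NBB : - B < B by lra.
(* The first component vanishes at both ends of the segment. *)
have flux0 c : \int[mu]_(a in `[-B, B]) partial 0 (G 0) (pt a c) = 0.
  rewrite /Rintegral (@continuous_FTC2 R _ (fun a => G 0 (pt a c)) (-B) B) //.
  - by rewrite !G0 ?sube0//; exists 0; rewrite pt0 ?normrN ler_norm.
  - exact/continuous_subspaceT/cd'.
  - have cG : continuous (fun a => G 0 (pt a c)).
      move=> y; apply: continuous_comp; first exact: cont_ptl.
      by have [] := CG 0 (pt y c) I.
    split.
    + by move=> y _; have [] := C1_derive_ptl y c (CG 0).
    + exact/cvg_at_right_filter/cG.
    + exact/cvg_at_left_filter/cG.
  - by move=> y _; rewrite derive1E; have [] := C1_derive_ptl y c (CG 0).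
have sumE c : (fun a => \sum_i partial i (G i) (pt a c)) =
    (fun a => partial 0 (G 0) (pt a c) + partial 1 (G 1) (pt a c)).
  by apply/funext => y; rewrite sum_ord2.
have dh (c : R) : is_derive c 1 h (\int[mu]_(a in `[-B, B]) \sum_i partial i (G i) (pt a c)).
  have -> : \int[mu]_(a in `[-B, B]) \sum_i partial i (G i) (pt a c) =
      \int[mu]_(a in `[-B, B]) partial 1 (G 1) (pt a c).
    rewrite sumE RintegralD ?flux0 ?add0r //; exact/continuous_integrable/cd'.
  exact: derive_int_ptr.
have h0 y : h y = 0.
  have [By|By] := leP B `|y|.
    rewrite /h (_ : (fun a => G 1 (pt a y)) = cst 0) ?Rintegral_cst ?mul0r//.
    by apply/funext => z /=; rewrite G0//; exists 1; rewrite pt1.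
  have mono : forall y z, -B <= y -> y <= z -> z <= B -> h y <= h z.
    apply: ger0_derive1_ndecr.
    + by move=> z _; have [] := dh z.
    + move=> z _; rewrite derive1E; have [_ ->] := dh z.
      by apply: Rintegral_ge0.
    + apply/continuous_subspaceT => z; apply/differentiable_continuous/derivable1_diffP.
      by have [] := dh z.
  have hB z : B <= `|z| -> h z = 0.
    move=> Bz; rewrite /h (_ : (fun a => G 1 (pt a z)) = cst 0) ?Rintegral_cst ?mul0r//.
    by apply/funext => t /=; rewrite G0//; exists 1; rewrite pt1.
  move: By; rewrite ltr_norml => /andP[/ltW y1 /ltW y2].
  apply/eqP; rewrite eq_le -{1}(hB B) ?ler_norm// -(hB (-B)) ?normrN ?ler_norm//.
  by rewrite !mono// ltW.
have hE : h = cst 0 by apply/funext => y; exact: h0.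
apply: (@Rintegral_ge0_eq0 (fun a => \sum_i partial i (G i) (pt a b)) (-B) B).
- by rewrite sumE => y; apply: cvgD; exact: cd'.
- by move=> y; exact: dG.
- by have [_ <-] := dh b; rewrite hE derive_cst.
- by rewrite -ltr_norml.
Qed.

(** Enlarging the square brings any given point into its interior. *)
Lemma div_ge0_eq0 (G : 'I_2 -> V -> R) (B : R) :
  (forall i, C1_on setT (G i)) ->
  (forall i (x : V), (exists j, B <= `|x 0 j|) -> G i x = 0) ->
  (forall x, 0 <= \sum_i partial i (G i) x) ->
  forall x, \sum_i partial i (G i) x = 0.
Proof.
move=> CG G0 dG x.
apply: (@div_ge0_eq0_in G (`|B| + `|x 0 0| + 1)) => //.
  move=> i y [j Hj]; apply: G0; exists j; apply: le_trans Hj.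
  by rewrite (le_trans (ler_norm B))// -addrA lerDl addr_ge0.
by rewrite [X in X + 1]addrC -addrA ltrDl ltr_wpDl.
Qed.

End Divergence.

(** * Strict monotonicity of the flux *)

Section Coefficient.
Variable R : realType.
Implicit Types s t : R.

Definition coef s : R := (Num.sqrt (1 - s))^-1 - (Num.sqrt (1 + s))^-1.

Lemma coef_homo s t : 0 <= s -> s < t -> t < 1 -> coef s < coef t.
Proof.
move=> s0 st t1; rewrite /coef ltrB//.
  by rewrite ltf_pV2 ?posrE ?sqrtr_gt0 ?ltr_sqrt; lra.
by rewrite ltf_pV2 ?posrE ?sqrtr_gt0 ?ltr_sqrt; lra.
Qed.

Lemma coef0 : coef 0 = 0.
Proof. by rewrite /coef subr0 addr0 subrr. Qed.

Lemma coef_gt0 s : 0 < s -> s < 1 -> 0 < coef s.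
Proof. by move=> s0 s1; rewrite -coef0; exact: coef_homo. Qed.

Lemma coef_ge0 s : 0 <= s -> s < 1 -> 0 <= coef s.
Proof.
rewrite le_eqVlt => /predU1P[<-|s0 s1]; first by rewrite coef0.
exact/ltW/coef_gt0.
Qed.

Lemma coef_monoM s t : 0 <= s < 1 -> 0 <= t < 1 -> 0 <= (coef s - coef t) * (s - t).
Proof.
move=> /andP[s0 s1] /andP[t0 t1].
have [st|st|->] := ltgtP s t; last by rewrite !subrr mulr0.
- by rewrite mulr_le0 // subr_le0 ltW // coef_homo.
- by rewrite mulr_ge0 // subr_ge0 ltW // coef_homo.
Qed.

Variables p q : 'I_2 -> R.
Let s := \sum_i p i ^+ 2.
Let t := \sum_i q i ^+ 2.
Hypotheses (s1 : s < 1) (t1 : t < 1).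

Let s0 : 0 <= s. Proof. by apply: sumr_ge0 => i _; exact: sqr_ge0. Qed.
Let t0 : 0 <= t. Proof. by apply: sumr_ge0 => i _; exact: sqr_ge0. Qed.

(** Splitting a p - b q into its symmetric and antisymmetric parts,
    (a + b) / 2 (p - q) + (a - b) / 2 (p + q), separates the two sources of
    monotonicity: the sign of the coefficients and their growth with the norm. *)
Let mono_identity a b :
  \sum_i (a * p i - b * q i) * (p i - q i) =
  2^-1 * ((a + b) * \sum_i (p i - q i) ^+ 2 + (a - b) * (s - t)).
Proof. by rewrite /s /t !sum_ord2; field. Qed.

Lemma coef_monotone : 0 <= \sum_i (coef s * p i - coef t * q i) * (p i - q i).
Proof.
rewrite mono_identity mulr_ge0// addr_ge0//.
  apply: mulr_ge0; first by rewrite addr_ge0 ?coef_ge0.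
  by apply: sumr_ge0 => i _; exact: sqr_ge0.
by apply: coef_monoM; rewrite ?s0 ?t0.
Qed.

(** If the pairing vanishes then so does (coef s + coef t) |p - q|^2; either p = q,
    or both coefficients are zero, which forces p = q = 0. *)
Lemma coef_strictly_monotone :
  \sum_i (coef s * p i - coef t * q i) * (p i - q i) = 0 -> forall i, p i = q i.
Proof.
rewrite mono_identity => /eqP; rewrite mulf_eq0 invr_eq0 pnatr_eq0/=.
have sq0 : 0 <= \sum_i (p i - q i) ^+ 2 by apply: sumr_ge0 => i _; exact: sqr_ge0.
have cs := coef_ge0 s0 s1; have ct := coef_ge0 t0 t1.
rewrite paddr_eq0; last 2 first.
- by apply: mulr_ge0 => //; exact: addr_ge0.
- by apply: coef_monoM; rewrite ?s0 ?t0.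
move=> /andP[+ _]; rewrite mulf_eq0 => /orP[|].
  rewrite paddr_eq0// => /andP[/eqP cs0 /eqP ct0] i.
  have sz : s = 0.
    by apply/eqP; rewrite eq_le s0 andbT leNgt; apply/negP => /coef_gt0/(_ s1); rewrite cs0 ltxx.
  have tz : t = 0.
    by apply/eqP; rewrite eq_le t0 andbT leNgt; apply/negP => /coef_gt0/(_ t1); rewrite ct0 ltxx.
  move/eqP: sz; rewrite psumr_eq0 => [/allP/(_ i)|j _]; last exact: sqr_ge0.
  rewrite mem_index_enum sqrf_eq0 => /(_ isT)/eqP->.
  move/eqP: tz; rewrite psumr_eq0 => [/allP/(_ i)|j _]; last exact: sqr_ge0.
  by rewrite mem_index_enum sqrf_eq0 => /(_ isT)/eqP->.
move=> /eqP/eqP; rewrite psumr_eq0 => [/allP h i|j _]; last exact: sqr_ge0.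
have := h i; rewrite mem_index_enum sqrf_eq0 subr_eq0 => /(_ isT)/eqP; exact.
Qed.
End Coefficient.

(** * Truncation and extension by zero *)

Section Truncation.
Variable R : realType.

Lemma continuous_pos : continuous (fun t : R => Num.max 0 t).
Proof. by move=> t; apply: continuous_max; [exact: cst_continuous|]. Qed.

(** Squaring the positive part makes the truncation continuously differentiable. *)
Lemma is_derive_pos_sqr (x : R) :
  is_derive x 1 (fun t : R => Num.max 0 t ^+ 2) (2 * Num.max 0 x).
Proof.
have [x0|x0|->] := ltgtP x 0.
- apply: (@near_eq_is_derive _ _ _ (cst 0)).
    near=> y; have y0 : y < 0 by near: y; exact: lt_nbhsl.
    by rewrite /= max_l ?expr0n// ltW.
  by rewrite mulr0; exact: is_derive_cst.
- apply: (@near_eq_is_derive _ _ _ (fun t : R => t ^+ 2)).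
    near=> y; have y0 : 0 < y by near: y; exact: lt_nbhsr.
    by rewrite /= max_r // ltW.
  by apply: is_derive_eq; rewrite [_%:A]mulr1; ring.
(* At 0 the difference quotient of the squared positive part is the positive part
   itself. *)
- rewrite mulr0; apply: (is_derive1_caratheodory _ _ _).2; exists (fun t => Num.max 0 t).
  split; last exact: maxxx.
  + move=> z; rewrite maxxx expr0n/= !subr0.
    by have [z0|z0] := leP z 0; rewrite ?mul0r ?expr0n ?expr2.
  + exact: continuous_pos.
Unshelve. all: by end_near. Qed.
End Truncation.

Section Extension.
Variable R : realType.
Local Notation V := 'rV[R]_2.

(** Every point of the plane has a neighbourhood on which the extension coincides
    either with [g] or with the zero function. *)
Lemma C1_extend (Omega : set V) (g : V -> R) : open Omega -> C1_on Omega g ->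
  (forall x, ~ Omega x -> \forall y \near x, Omega y -> g y = 0) ->
  [/\ C1_on setT (g \_ Omega),
     forall x i, Omega x -> partial i (g \_ Omega) x = partial i g x &
     forall x i, ~ Omega x -> partial i (g \_ Omega) x = 0].
Proof.
move=> oO Cg g0.
have in_ x : Omega x -> g x = (g \_ Omega) x by move=> Ox; rewrite patchE mem_set.
have [C1 p1] := C1_eq_on oO in_ Cg.
have nz x : ~ Omega x -> exists N, [/\ open N, N x & forall y, N y -> 0 = (g \_ Omega) y].
  move=> /g0; rewrite /prop_near1 nbhsE => -[N [oN Nx] HN]; exists N; split=> // y Ny.
  rewrite patchE; case: ifPn => // yO; apply/esym; apply: HN => //; exact: set_mem.
have C0 x : ~ Omega x -> (forall i, partial i (g \_ Omega) x = 0) /\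
   exists2 N : set V, N x & C1_on N (g \_ Omega).
  move=> /nz[N [oN Nx HN]]; have [C p] := C1_eq_on oN HN (C1_cst 0 oN).
  split; last by exists N.
  by move=> i; rewrite p// /partial derive_cst.
split.
- move=> x _; have [Ox|/C0[_ [N Nx CN]]] := pselect (Omega x); first exact: C1.
  exact: CN.
- exact: p1.
- by move=> x i /C0[].
Qed.
End Extension.

(** * Comparison of solutions *)

Section Uniqueness.
Variable R : realType.
Local Notation V := 'rV[R]_2.
Implicit Types (Omega : set V) (u v : V -> R).

Lemma smooth_C1 Omega u : smooth_on Omega u -> C1_on Omega u.
Proof.
move=> su x Ox; have [cu du] := su [::] x Ox; split=> // i; split; first exact: du.
by have [] := su [:: i] x Ox.
Qed.

Lemma smooth_partial Omega u i : smooth_on Omega u -> smooth_on Omega (partial i u).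
Proof. by move=> su s x Ox; have := su (rcons s i) x Ox; rewrite foldr_rcons. Qed.

Lemma enorm_sqr (p : V) : enorm p ^+ 2 = \sum_i p 0 i ^+ 2.
Proof. by rewrite sqr_sqrtr// sumr_ge0// => i _; exact: sqr_ge0. Qed.

Lemma sqr_slope u x : enorm (grad u x) ^+ 2 = \sum_i partial i u x ^+ 2.
Proof. by rewrite enorm_sqr; apply: eq_bigr => i _; rewrite mxE. Qed.

(** The vector field A(Du) whose divergence is the left-hand side of the equation. *)
Definition flux u x : V := coef (enorm (grad u x) ^+ 2) *: grad u x.

Lemma fluxE u x i :
  flux u x 0 i = coef (\sum_i partial i u x ^+ 2) * partial i u x.
Proof. by rewrite /flux sqr_slope !mxE. Qed.

Lemma C1_invsqrt Omega (f : V -> R) : open Omega -> C1_on Omega f ->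
  (forall x, Omega x -> 0 < f x) -> C1_on Omega (fun x => (Num.sqrt (f x))^-1).
Proof.
move=> oO Cf f0.
apply: (@C1_comp _ _ (fun s => (Num.sqrt s)^-1)
  (fun s : R => - (Num.sqrt s) ^- 2 *: (2 * Num.sqrt s)^-1) _ oO Cf) => x Ox.
  apply: is_deriveV; first by rewrite gt_eqF// sqrtr_gt0 f0.
  exact/is_derive1_sqrt/f0.
have sq0 : Num.sqrt (f x) != 0 by rewrite gt_eqF// sqrtr_gt0 f0.
apply: cvgM.
  apply: cvgN; apply: cvgV; first by rewrite expf_neq0.
  by apply: cvgM; exact: sqrt_continuous.
apply: cvgV; first by rewrite mulf_neq0 ?pnatr_eq0.
by apply: cvgM; [exact: cvg_cst|exact: sqrt_continuous].
Qed.

Lemma C1_flux Omega u i : open Omega -> smooth_on Omega u ->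
  (forall x, Omega x -> enorm (grad u x) < 1) ->
  C1_on Omega (fun x => flux u x 0 i).
Proof.
move=> oO su u1.
under eq_fun do rewrite fluxE sum_ord2 /coef.
have Cp j : C1_on Omega (partial j u) by exact/smooth_C1/smooth_partial.
have Cs : C1_on Omega (fun x => partial 0 u x ^+ 2 + partial 1 u x ^+ 2).
  exact: (C1D oO (C1M oO (Cp 0) (Cp 0)) (C1M oO (Cp 1) (Cp 1))).
have s1 x : Omega x -> 0 <= partial 0 u x ^+ 2 + partial 1 u x ^+ 2 < 1.
  move=> Ox; rewrite addr_ge0 ?sqr_ge0//= -(sum_ord2 (fun i => partial i u x ^+ 2)) -sqr_slope.
  by rewrite expr_lt1 ?u1// sqrtr_ge0.
have C1 := C1_cst (1 : R) oO.
apply: (C1M oO _ (Cp i)); apply: (C1B oO); apply: (C1_invsqrt oO).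
- exact: (C1B oO C1 Cs).
- by move=> x /s1/andP[_ ?]; rewrite subr_gt0.
- exact: (C1D oO C1 Cs).
- by move=> x /s1/andP[? _]; rewrite ltr_pwDl.
Qed.

Lemma flux_monotone u v x : enorm (grad u x) < 1 -> enorm (grad v x) < 1 ->
  0 <= \sum_i (flux u x 0 i - flux v x 0 i) * (partial i u x - partial i v x).
Proof.
move=> u1 v1; under eq_bigr do rewrite !fluxE.
by apply: (@coef_monotone _ (fun i => partial i u x) (fun i => partial i v x));
  rewrite -sqr_slope expr_lt1// sqrtr_ge0.
Qed.

Lemma flux_strictly_monotone u v x : enorm (grad u x) < 1 -> enorm (grad v x) < 1 ->
  \sum_i (flux u x 0 i - flux v x 0 i) * (partial i u x - partial i v x) = 0 ->
  forall i, partial i u x = partial i v x.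
Proof.
move=> u1 v1; under eq_bigr do rewrite !fluxE.
by apply: (@coef_strictly_monotone _ (fun i => partial i u x) (fun i => partial i v x));
  rewrite -sqr_slope expr_lt1// sqrtr_ge0.
Qed.

(** A boundary point is reached through the continuity of [w] on the closure, an
    exterior point has a neighbourhood that misses [Omega]. *)
Lemma within_near_lt Omega (w : V -> R) e x : {within closure Omega, continuous w} ->
  ~ Omega x -> (closure Omega x -> w x < e) ->
  \forall y \near x, Omega y -> w y < e.
Proof.
move=> cw nO we; have [cx|ncx] := pselect (closure Omega x).
  have /subspace_continuousP/(_ x cx) := cw.
  move=> /cvgr_lt/(_ _ (we cx)); rewrite near_withinE.
  by apply: filterS => y h Oy; apply: h; exact: subset_closure.
have : nbhs x (~` closure Omega).
  by apply: open_nbhs_nbhs; split=> //; exact/closed_openC/closed_closure.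
by apply: filterS => y nc Oy; case: nc; exact: subset_closure.
Qed.

Lemma coord_le_norm (x : V) j : `|x 0 j| <= `|x|.
Proof. by rewrite [leRHS]mx_normrE; exact: (le_bigmax _ (fun ij => `|x ij.1 ij.2|) (0, j)). Qed.

(** Along each horizontal line [f] is constant, and it is zero far away. *)
Lemma C1_partial0_eq0 (f : V -> R) B : C1_on setT f ->
  (forall x, partial 0 f x = 0) -> (forall x : V, B <= `|x 0 0| -> f x = 0) ->
  forall x, f x = 0.
Proof.
move=> Cf df f0 x; rewrite (ptE x).
have -> : f (pt (x 0 0) (x 0 1)) = f (pt B (x 0 1)).
  apply: (@is_derive_0_is_cst _ (fun a => f (pt a (x 0 1)))) => a.
  by rewrite -(df (pt a (x 0 1))); exact: C1_derive_ptl.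
by apply: f0; rewrite pt0 ler_norm.
Qed.

(** The energy argument.  The margin [e] keeps the support of the truncation
    [psi] away from the boundary, where the fluxes of [u] and [v] may be unbounded. *)
Lemma dirichlet_comparison Omega phi u v : open Omega -> bounded_set Omega ->
  dirichlet_solution Omega phi u -> dirichlet_solution Omega phi v ->
  forall x, Omega x -> u x <= v x.
Proof.
move=> oO bO [su cu eu u1 bu] [sv cv ev v1 bv] x Ox.
rewrite -subr_le0; apply/ler_addgt0Pl => e e0; rewrite addr0.
pose w y := u y - v y - e.
pose psi y := Num.max 0 (w y) ^+ 2.
have Cu := smooth_C1 su; have Cv := smooth_C1 sv.
have Cw : C1_on Omega w := C1B oO (C1B oO Cu Cv) (C1_cst e oO).
have dw i y : Omega y -> is_derive y (delta_mx 0 i) w (partial i u y - partial i v y).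
  move=> Oy; rewrite -[X in is_derive _ _ _ X]subr0.
  apply: is_deriveB; apply: is_deriveB; exact: C1_is_derive Oy.
have Cpsi : C1_on Omega psi.
  apply: (@C1_comp _ _ (fun t : R => Num.max 0 t ^+ 2) (fun t => 2 * Num.max 0 t) _ oO Cw).
    by move=> y _; exact: is_derive_pos_sqr.
  move=> y _; apply: cvgM; first exact: cvg_cst.
  exact: continuous_pos.
have dpsi i y : Omega y ->
    partial i psi y = 2 * Num.max 0 (w y) * (partial i u y - partial i v y).
  move=> Oy; have [dwy dwE] := dw i y Oy.
  have [_] := is_derive_comp_dir (is_derive_pos_sqr (w y)) dwy.
  by rewrite dwE.
have psi0 y : ~ Omega y -> \forall z \near y, Omega z -> psi z = 0.
  move=> nO.
  have : \forall z \near y, Omega z -> u z - v z < e.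
    apply: within_near_lt => //; first by move=> z; apply: cvgB; [exact: cu|exact: cv].
    move=> cy; have byd : boundary Omega y by split=> // /interior_subset.
    by rewrite bu// bv// subrr.
  apply: filterS => z h /h wz; rewrite /psi max_l ?expr0n// /w; lra.
pose X i y := flux u y 0 i - flux v y 0 i.
have CX i : C1_on Omega (X i) := C1B oO (C1_flux i oO su u1) (C1_flux i oO sv v1).
pose g i y := psi y * X i y.
have Cg i : C1_on Omega (g i) := C1M oO Cpsi (CX i).
have g0 i y : ~ Omega y -> \forall z \near y, Omega z -> g i z = 0.
  by move=> /psi0; apply: filterS => z h /h; rewrite /g => ->; rewrite mul0r.
(* The difference of the two fluxes is divergence free. *)
have divX y : Omega y -> partial 0 (X 0) y = - partial 1 (X 1) y.
  move=> Oy; apply/eqP; rewrite -addr_eq0; apply/eqP.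
  have dX i : partial i (X i) y =
      partial i (fun z => flux u z 0 i) y - partial i (fun z => flux v z 0 i) y.
    by have [_ <-] := is_deriveB (C1_is_derive i (C1_flux i oO su u1) Oy)
      (C1_is_derive i (C1_flux i oO sv v1) Oy).
  have du0 : \sum_i partial i (fun z => flux u z 0 i) y = 0 := eu y Oy.
  have dv0 : \sum_i partial i (fun z => flux v z 0 i) y = 0 := ev y Oy.
  rewrite sum_ord2 in du0; rewrite sum_ord2 in dv0.
  have cancel a b c d : a + b = 0 -> c + d = 0 -> a - c + (b - d) = 0 :> R.
    by move=> ab cd; rewrite addrACA -opprD ab cd subrr.
  rewrite !dX; exact: (cancel _ _ _ _ du0 dv0).
have divg y : Omega y -> \sum_i partial i (g i) y =
    2 * Num.max 0 (w y) * \sum_i X i y * (partial i u y - partial i v y).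
  move=> Oy.
  have dg i : partial i (g i) y = psi y * partial i (X i) y +
      X i y * (2 * Num.max 0 (w y) * (partial i u y - partial i v y)).
    rewrite -dpsi//.
    by have [_ <-] := is_deriveM (C1_is_derive i Cpsi Oy) (C1_is_derive i (CX i) Oy).
  rewrite !sum_ord2 !dg divX//; ring.
have [M [_ HM]] := bO.
have far (y : V) j : `|M| + 1 < `|y 0 j| -> ~ Omega y.
  move=> yj /(HM (`|M| + 1)); rewrite ltr_pwDr ?ler_norm// => /(_ isT).
  by move=> /(le_trans (coord_le_norm y j)); rewrite leNgt yj.
have ext (f : V -> R) y : ~ Omega y -> (f \_ Omega) y = 0 :> R.
  by move=> nO; rewrite patchE memNset.
pose B := `|M| + 2.
have farB (y : V) j : B <= `|y 0 j| -> ~ Omega y.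
  by move=> Hj; apply: (far y j); rewrite /B in Hj; lra.
have ext_g i := C1_extend oO (Cg i) (g0 i).
have div_ge0 y : 0 <= \sum_i partial i (g i \_ Omega) y.
  have [Oy|nO] := pselect (Omega y); last first.
    by rewrite big1// => i _; have [_ _ ->] := ext_g i.
  rewrite (eq_bigr (fun i => partial i (g i) y)); last first.
    by move=> i _; have [_ E _] := ext_g i; exact: E.
  rewrite divg//; apply: mulr_ge0; first by rewrite mulr_ge0// le_max lexx.
  exact: (flux_monotone (u1 y Oy) (v1 y Oy)).
have div_eq0 y : \sum_i partial i (g i \_ Omega) y = 0.
  apply: (@div_ge0_eq0 R (fun i => g i \_ Omega) B) => //.
    by move=> i; have [] := ext_g i.
  by move=> i z [j /farB nO]; exact: ext.
have [Cpe pe pe0] := C1_extend oO Cpsi psi0.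
(* Where div g = 0, either the truncation factor or the difference of the
   gradients vanishes, and each of the two kills the gradient of [psi]. *)
have dpe0 y : partial 0 (psi \_ Omega) y = 0.
  have [Oy|nO] := pselect (Omega y); last by rewrite pe0.
  rewrite pe// dpsi//.
  have := div_eq0 y; rewrite (eq_bigr (fun i => partial i (g i) y)); last first.
    by move=> i _; have [_ E _] := ext_g i; exact: E.
  rewrite divg// => /eqP; rewrite mulf_eq0 => /orP[/eqP->|/eqP]; first by rewrite mul0r.
  by move=> /(flux_strictly_monotone (u1 y Oy) (v1 y Oy))->; rewrite subrr mulr0.
have : (psi \_ Omega) x = 0.
  by apply: (C1_partial0_eq0 Cpe dpe0 (B := B)) => y /farB; exact: ext.
rewrite patchE mem_set// /psi => /eqP; rewrite sqrf_eq0 => /eqP mx.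
have : w x <= 0 by rewrite -mx le_max lexx orbT.
by rewrite /w subr_le0.
Qed.

End Uniqueness.

Theorem corollary1 (R : realType) (Omega : set 'rV[R]_2)
  (Omega_domain : domain Omega) (Omega_bounded : bounded_set Omega)
  (phi u : 'rV[R]_2 -> R)
  (u_solution : dirichlet_solution Omega phi u)
  (u_curved : nonvanishing_mean_curvature Omega u) :
  forall v : 'rV[R]_2 -> R, dirichlet_solution Omega phi v ->
    forall x, closure Omega x -> v x = u x.
Proof.
move=> v v_solution x cx; have [oO _ _] := Omega_domain.
have [Ox|nO] := pselect (Omega x).
  by apply/eqP; rewrite eq_le !(dirichlet_comparison (phi := phi) oO).
have bx : boundary Omega x by split=> // /interior_subset.
have [_ _ _ _ ->] := v_solution; last by [].
by have [_ _ _ _ ->] := u_solution.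
Qed.
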